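(* Consider the networked control system described in the context with initial distribution $\pi_0$ and discount factor $\beta\in(0,1)$, and the problem of attaining $$J_\beta(\pi_0)=\inf_{\overline\gamma\in\Gamma_A}J_\beta(\pi_0,\overline\gamma).$$ There exists an optimal policy that belongs to $\Gamma_{C-P}$ and is stationary: there are maps $\gamma^e:\mathcal{P}(\mathbb{X})\to\mathcal{Q}$ and $\gamma^c:\mathcal{P}(\mathbb{X})\to\mathcal{H}$, not depending on $t$, such that the policy $\overline\gamma^*$ using $Q_t=\gamma^e(\pi_t)$, $\eta_t=\gamma^c(\pi_t)$ for all $t\ge0$ satisfies $J_\beta(\pi_0,\overline\gamma^* )=J_\beta(\pi_0)$.
   Context: $\mathbb{X}$ (states), $\mathbb{U}$ (actions), $\mathbb{M}$ (channel symbols) are finite nonempty sets. The source evolves as $x_{t+1}=f(x_t,u_t,w_t)$, $t\ge0$, with $(w_t)$ i.i.d. and independent of $x_0\sim\pi_0$; $P(x'\mid x,u)=\mathrm{Prob}(f(x,u,w_t)=x')$. $c:\mathbb{X}\times\mathbb{U}\to\mathbb{R}$ is a cost function. Admissible policies $\Gamma_A$: sequences $\overline\gamma=\{(\gamma_t^e,\gamma_t^c)\}_{t\ge0}$ of (measurable) functions with $q_t=\gamma_t^e(x_{[0,t]},q_{[0,t-1]})\in\mathbb{M}$ (encoder) and $u_t=\gamma_t^c(q_{[0,t]},u_{[0,t-1]})\in\mathbb{U}$ (controller; the channel is noiseless). The discounted cost is $J_\beta(\pi_0,\overline\gamma)=\lim_{N\to\infty}E^{\overline\gamma}_{\pi_0}\big[\sum_{k=0}^{N-1}\beta^k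 c(x_k,u_k)\big]$. Let $\mathcal{Q}=\{Q:\mathbb{X}\to\mathbb{M}\}$, $\mathcal{H}=\{\eta:\mathcal{Q}\times\mathbb{M}\to\mathbb{U}\}$, and let $\mathcal{P}(\mathbb{X})$ be the set of probability measures on $\mathbb{X}$ with the weak topology. A policy in $\Gamma_{C-P}\subset\Gamma_A$ is given by measurable maps $\gamma_t^e:\mathcal{P}(\mathbb{X})\to\mathcal{Q}$, $\gamma_t^c:\mathcal{P}(\mathbb{X})\to\mathcal{H}$, with $Q_t=\gamma^e_t(\pi_t)$, $\eta_t=\gamma^c_t(\pi_t)$, $q_t=Q_t(x_t)$, $u_t=\eta_t(Q_t,q_t)$, where $\pi_t(\cdot)=P^{\overline\gamma}(x_t=\cdot\mid q_{[0,t-1]})$ is the predictor, computed recursively from $\pi_0$ by $$\pi_{t+1}(x')=\frac{1}{\pi_t(Q_t^{-1}(q_t))}\sum_{x\in Q_t^{-1}(q_t)}P(x'\mid x,\eta_t(Q_t,q_t))\,\pi_t(x).$$ For $\overline\gamma\in\Gamma_{C-P}$ one has $J_\beta(\pi_0,\overline\gamma)=\lim_N E^{\overline\gamma}_{\pi_0}\big[\sum_{k=0}^{N-1}\beta^k\tilde c(\pi_k,Q_k,\eta_k)\big]$ with $\tilde c(\pi,Q,\eta)=\sum_{x}\pi(x)c(x,\eta(Q,Q(x)))$. *)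

(* Defs.v *)
From HB Require Import structures.
From mathcomp Require Import all_boot all_order all_algebra.
From mathcomp Require Import all_classical all_reals all_analysis.
Import Order.TTheory GRing.Theory Num.Theory.
Import numFieldNormedType.Exports.

Set Implicit Arguments.
Unset Strict Implicit.
Unset Printing Implicit Defensive.

Local Open Scope classical_set_scope.
Local Open Scope ring_scope.

(** * Probability measures on a finite set *)

Record pmeas (R : realType) (X : finType) := PMeas {
  pmass :> {ffun X -> R};
  _ : [forall x, 0 <= pmass x] && (\sum_x pmass x == 1) }.

HB.instance Definition _ (R : realType) (X : finType) :=
  [isSub for @pmass R X].
HB.instance Definition _ (R : realType) (X : finType) :=
  [Choice of pmeas R X by <:].

(* pi |-> (g |-> \int g dpi); every g is bounded continuous as X is discrete. *)
Definition pmeas_integral (R : realType) (X : finType) (pi : pmeas R X) :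
  {ptws (X -> R) -> R} := fun g => \sum_x pi x * g x.

(* The weak topology: the coarsest one making every pi |-> \int g dpi
   continuous. *)
Definition weak_pmeas (R : realType) (X : finType) : topologicalType :=
  initial_topology (@pmeas_integral R X).

(* Borel measurability; the finite codomain carries its discrete
   sigma-algebra. *)
Definition borel_map (R : realType) (X T : finType) (g : pmeas R X -> T) :=
  forall A : set T,
    <<s [set O : set (weak_pmeas R X) | open O] >> (g @^-1` A).

(** * The noise *)

Section noise.
Context d (Om : measurableType d) (R : realType) (P : probability Om R).
Context d' (W : measurableType d').
Implicit Types w : nat -> {mfun Om >-> W}.

Definition identically_distributed w :=
  forall t (B : set W), measurable B ->
    distribution P (w t) B = distribution P (w 0%N) B.

Definition mutually_independent w :=
  forall (s : seq nat) (B : nat -> set W), uniq s ->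
    (forall t, measurable (B t)) ->
    P (\bigcap_(t in [set` s]) (w t @^-1` B t)) =
      (\prod_(t <- s) P (w t @^-1` B t))%E.

Definition process_events w : set (set Om) :=
  <<s [set E | exists t B, measurable B /\ E = w t @^-1` B] >>.

Definition independent_of_process (X : finType) (x0 : Om -> X) w :=
  forall (A : set X) (E : set Om), process_events w E ->
    P (x0 @^-1` A `&` E) = (P (x0 @^-1` A) * P E)%E.

End noise.

(** * Admissible policies and the controlled process *)

Section policies.
Context (X U M : finType).

(* Only the values met along an actual history are recorded:
   adm_enc t takes x_[0,t] and q_[0,t-1]; adm_ctl t takes q_[0,t] and
   u_[0,t-1].  The domains are finite, so measurability is automatic. *)
Record adm_policy := AdmPolicy {
  adm_enc : forall t, t.+1.-tuple X -> t.-tuple M -> M;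
  adm_ctl : forall t, t.+1.-tuple M -> t.-tuple U -> U }.

Record history t := History {
  hist_x : t.+1.-tuple X;
  hist_q : t.-tuple M;
  hist_u : t.-tuple U }.

Definition hist_state t (h : history t) : X := tnth (hist_x h) ord_max.

Definition hist_symbols g t (h : history t) : t.+1.-tuple M :=
  [tuple of rcons (hist_q h) (adm_enc g (hist_x h) (hist_q h))].

Definition hist_action g t (h : history t) : U :=
  adm_ctl g (hist_symbols g h) (hist_u h).

(* (x_[0,t], q_[0,t-1], u_[0,t-1]) from x_0 and a noise realization v. *)
Fixpoint run (W : Type) (f : X -> U -> W -> X) g (x0 : X) (v : nat -> W) t :
    history t :=
  if t is t'.+1 then
    let h := run f g x0 v t' in
    let u := hist_action g h in
    History [tuple of rcons (hist_x h) (f (hist_state h) u (v t'))]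
            (hist_symbols g h)
            [tuple of rcons (hist_u h) u]
  else History [tuple x0] [tuple] [tuple].

End policies.

(** * The discounted cost *)

Section cost.
Context d (Om : measurableType d) (R : realType) (P : probability Om R).
Context d' (W : measurableType d') (X U M : finType).
Context (f : X -> U -> W -> X) (x0 : Om -> X) (w : nat -> {mfun Om >-> W}).
Context (c : X -> U -> R) (beta : R).
Implicit Types g : adm_policy X U M.

Definition state g t (o : Om) : X := hist_state (run f g (x0 o) (w ^~ o) t).

Definition action g t (o : Om) : U := hist_action g (run f g (x0 o) (w ^~ o) t).

Definition discounted_cost g : \bar R :=
  limn (fun N => 'E_P[fun o =>
    (\sum_(k < N) beta ^+ k * c (state g k o) (action g k o))%R])%E.

(* P(x' | x, u); the choice of w_0 is immaterial for i.i.d. noise. *)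
Definition transition (x : X) (u : U) (x' : X) : R :=
  fine (P [set o | f x u (w 0%N o) = x']).

End cost.

(** * Policies driven by the predictor *)

Section predictor.
Context (R : realType) (X U M : finType).

Definition quantizer := {ffun X -> M}.
Definition ctrl_map := {ffun quantizer * M -> U}.

Context (K : X -> U -> X -> R) (pi0 : pmeas R X).
Context (ge : nat -> pmeas R X -> quantizer) (gc : nat -> pmeas R X -> ctrl_map).

(* When the symbol q has probability zero under pi, the formula (with 1/0 = 0)
   is not a probability vector, and insubd then leaves pi unchanged. *)
Definition predictor_step (Q : quantizer) (eta : ctrl_map) (q : M)
    (pi : pmeas R X) : pmeas R X :=
  insubd pi [ffun x' =>
    (\sum_(x | Q x == q) pi x)^-1 *
    \sum_(x | Q x == q) K x (eta (Q, q)) x' * pi x].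

(* Predictor reached from pi at time t after receiving the symbols s. *)
Fixpoint predictor_from t (pi : pmeas R X) (s : seq M) : pmeas R X :=
  if s is q :: s' then
    predictor_from t.+1 (predictor_step (ge t pi) (gc t pi) q pi) s'
  else pi.

Definition predictor (s : seq M) : pmeas R X := predictor_from 0 pi0 s.

(* Here s = q_[0,t-1], so that pi_t = predictor s; in the controller
   rcons s q_t is given and its last entry is q_t. *)
Definition cp_policy : adm_policy X U M := {|
  adm_enc := fun t xs s => ge t (predictor s) (tnth xs ord_max);
  adm_ctl := fun t s _ =>
    let pi := predictor (take t s) in
    gc t pi (ge t pi, tnth s ord_max) |}.

End predictor.

(* Main.v *)
Require Import Defs.
From HB Require Import structures.
From mathcomp Require Import all_boot all_order all_algebra.
From mathcomp Require Import all_classical all_reals all_analysis.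
From mathcomp Require Import ring lra.
Import Order.TTheory GRing.Theory Num.Theory.
Import numFieldNormedType.Exports.

Set Implicit Arguments.
Unset Strict Implicit.
Unset Printing Implicit Defensive.

Local Open Scope classical_set_scope.
Local Open Scope ring_scope.

(** The discounted cost to go is controlled by a value function [value] living on
unnormalised measures [mu] on the state space.  The measure [mu] stands for the
joint law of the event that the controller has seen a given string of symbols
and of the current state; its mass is the probability of that string and its
normalisation is the predictor.  On such measures everything is linear:
receiving the symbol [m] from the quantizer [Q] restricts [mu] to the cell of
[m] ([restr]), applying the action [u] pushes it forward through the transition
kernel ([push]), and the Bellman operator ([bellman]) needs no division by the
probability of the symbol.

The difficulty is that an admissible encoder sees the whole past of the source.
Given the present state and the information of the controller it therefore acts
like a randomised quantizer: it splits [mu] into arbitrary measures [nu m]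
summing to [mu], not only into the restrictions of [mu] to the cells of a map
[Q].  The value function is superadditive and positively homogeneous
([value_superlinear]), because this holds for a linear function and is preserved
by [bellman].  Every splitting is a convex combination of splittings along maps
[Q], with product weights, so superlinearity shows that no splitting beats the
best map ([bellman_le_split]).  By induction on the horizon, the cost of an
admissible policy is at least the value of the initial law up to a geometrically
small error ([cost_to_go_ge_value]); the same induction gives the opposite
inequality for the policy that plays a minimiser of the Bellman equation at the
current predictor ([cost_to_go_greedy_le]).

These inductions are about finite sums over histories.  They are transferred to
the probability space through the law of the controlled process, which is Markov
because a history up to time [t] involves the noise before time [t] only
([hist_future_indep]).

The decision maps can be made Borel because from a fixed initial law only
countably many predictors can occur, whatever the quantizers and the control
maps ([reachable_countable]).  The minimiser is used on this countable set and a
constant elsewhere, and such a map is Borel since points are closed in the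
weak topology ([borel_patch_off]). *)

(** * Limits up to a geometric error *)

Lemma limit_ge_geometric_gap (R : realType) (b e x J : R) (u : nat -> R) :
  0 <= b < 1 -> u @ \oo --> J -> (forall n, x <= u n + e * b ^+ n) -> x <= J.
Proof.
move=> /andP[b0 b1] uJ xu.
have cv : (fun n => u n + e * b ^+ n) @ \oo --> J.
  rewrite -[J]addr0 -(mulr0 e); apply: cvgD; first exact: uJ.
  by apply: cvgMr; apply: cvg_expr; rewrite ger0_norm.
rewrite -(cvg_lim _ cv)//.
by apply: limr_ge; [apply/cvg_ex; exists J | near=> n].
Unshelve. all: by end_near. Qed.

Lemma ler_geometric_gap (R : realType) (b e x y : R) :
  0 <= b < 1 -> (forall n, x <= y + e * b ^+ n) -> x <= y.
Proof. by move=> b01; apply: limit_ge_geometric_gap b01 _; exact: cvg_cst. Qed.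

(** * The Bellman operator on unnormalised measures *)

Section dynamic_programming.
Context (R : realType) (X U M : finType).
Context (K : X -> U -> X -> R) (c : X -> U -> R) (beta : R).
Hypothesis K_ge0 : forall x u x', 0 <= K x u x'.
Hypothesis K_sum1 : forall x u, \sum_x' K x u x' = 1.
Hypothesis beta01 : 0 < beta < 1.

Let meas := {ffun X -> R}.
Let decision := (quantizer X M * ctrl_map X U M)%type.
Context (a0 : decision).

Implicit Types (mu nu : meas) (F G : meas -> R) (Q : quantizer X M) (a : decision).

Let beta_ge0 : 0 <= beta. Proof. by case/andP: beta01 => /ltW. Qed.

Definition mass mu : R := \sum_x mu x.

Definition push u mu : meas := [ffun x' => \sum_x K x u x' * mu x].

Definition restr Q (m : M) mu : meas :=
  [ffun x => if Q x == m then mu x else 0].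

(** Running cost plus discounted continuation once the symbol is received and the
    action [u] is chosen; [mu] is then the part of the law carried by that
    symbol. *)
Definition branch F u mu : R := \sum_x mu x * c x u + beta * F (push u mu).

Definition stage F mu a : R :=
  \sum_m branch F (a.2 (a.1, m)) (restr a.1 m mu).

Definition greedy F mu : decision := [arg min_(a < a0) stage F mu a]%O.

Definition bellman F mu : R := stage F mu (greedy F mu).

Lemma bellman_le F mu a : bellman F mu <= stage F mu a.
Proof. by rewrite /bellman /greedy; case: arg_minP => // i _; apply. Qed.

(** Unfolds the scaling of the values, which lie in [R], to a product. *)
Lemma scale_measE s mu x : (s *: mu) x = s * mu x.
Proof. by rewrite ffunE. Qed.

Lemma mass_ge0 mu : (forall x, 0 <= mu x) -> 0 <= mass mu.
Proof. by move=> mu0; apply: sumr_ge0. Qed.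

Lemma massZ s mu : mass (s *: mu) = s * mass mu.
Proof. by rewrite /mass mulr_sumr; apply: eq_bigr => x _; rewrite ffunE. Qed.

Lemma push_ge0 u mu : (forall x, 0 <= mu x) -> forall x, 0 <= push u mu x.
Proof. by move=> mu0 x; rewrite ffunE sumr_ge0// => y _; rewrite mulr_ge0. Qed.

Lemma restr_ge0 Q m mu :
  (forall x, 0 <= mu x) -> forall x, 0 <= restr Q m mu x.
Proof. by move=> mu0 x; rewrite ffunE; case: ifP. Qed.

Lemma mass_push u mu : mass (push u mu) = mass mu.
Proof.
rewrite /mass; under eq_bigr do rewrite ffunE.
rewrite exchange_big/=; apply: eq_bigr => x _.
by rewrite -mulr_suml K_sum1 mul1r.
Qed.

Lemma sum_restr Q mu x : \sum_m restr Q m mu x = mu x.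
Proof.
under eq_bigr do rewrite ffunE.
by rewrite -big_mkcond/= (big_pred1 (Q x))// => m; rewrite eq_sym.
Qed.

Lemma sum_mass_restr Q mu : \sum_m mass (restr Q m mu) = mass mu.
Proof.
by rewrite /mass exchange_big/=; apply: eq_bigr => x _; exact: sum_restr.
Qed.

Lemma push_sum (I : finType) (l : I -> R) (nu : I -> meas) u :
  push u (\sum_i l i *: nu i) = \sum_i l i *: push u (nu i).
Proof.
apply/ffunP => x'; rewrite ffunE sum_ffunE.
under eq_bigr do rewrite sum_ffunE mulr_sumr.
rewrite exchange_big/=; apply: eq_bigr => i _.
rewrite scale_measE ffunE mulr_sumr; apply: eq_bigr => x _.
by rewrite scale_measE mulrCA.
Qed.

Lemma restr_sum (I : finType) (l : I -> R) (nu : I -> meas) Q m :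
  restr Q m (\sum_i l i *: nu i) = \sum_i l i *: restr Q m (nu i).
Proof.
apply/ffunP => x; rewrite ffunE !sum_ffunE; case: ifP => Qx.
  by apply: eq_bigr => i _; rewrite !scale_measE ffunE Qx.
by rewrite big1// => i _; rewrite scale_measE ffunE Qx mulr0.
Qed.

Lemma mass_sum (I : finType) (l : I -> R) (nu : I -> meas) :
  mass (\sum_i l i *: nu i) = \sum_i l i * mass (nu i).
Proof.
rewrite /mass; under eq_bigr do rewrite sum_ffunE.
rewrite exchange_big/=; apply: eq_bigr => i _.
by rewrite mulr_sumr; apply: eq_bigr => x _; rewrite scale_measE.
Qed.

Lemma restrZ Q m s mu : restr Q m (s *: mu) = s *: restr Q m mu.
Proof.
by apply/ffunP => x; rewrite ffunE !scale_measE ffunE; case: ifP => // _; rewrite mulr0.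
Qed.

Lemma pushZ u s mu : push u (s *: mu) = s *: push u mu.
Proof.
apply/ffunP => x; rewrite scale_measE !ffunE mulr_sumr; apply: eq_bigr => y _.
by rewrite scale_measE mulrCA.
Qed.

(** Superadditivity and positive homogeneity in one condition, a Jensen inequality
    for nonnegative weights of arbitrary total mass.  This form is inherited by
    sums, by compositions with linear maps and by minima. *)
Definition superlinear F := forall (I : finType) (l : I -> R) (nu : I -> meas),
  (forall i, 0 <= l i) -> (forall i x, 0 <= nu i x) ->
  \sum_i l i * F (nu i) <= F (\sum_i l i *: nu i).

Lemma branch_superlinear F u : superlinear F -> superlinear (branch F u).
Proof.
move=> FS I l nu l0 nu0; rewrite /branch push_sum.
under eq_bigr do rewrite mulrDr.
rewrite big_split/= lerD//.
  rewrite le_eqVlt; apply/orP; left; apply/eqP.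
  under [RHS]eq_bigr do rewrite sum_ffunE mulr_suml.
  rewrite [RHS]exchange_big/=; apply: eq_bigr => i _.
  by rewrite mulr_sumr; apply: eq_bigr => x _; rewrite scale_measE mulrA.
under eq_bigr do rewrite mulrCA.
rewrite -mulr_sumr ler_wpM2l// FS// => i.
exact: push_ge0.
Qed.

Lemma bellman_superlinear F : superlinear F -> superlinear (bellman F).
Proof.
move=> FS I l nu l0 nu0; rewrite {2}/bellman; set a := greedy F _.
apply: (@le_trans _ _ (\sum_i l i * stage F (nu i) a)).
  by apply: ler_sum => i _; rewrite ler_wpM2l// bellman_le.
rewrite /stage; under eq_bigr do rewrite mulr_sumr.
rewrite exchange_big/=; apply: ler_sum => m _; rewrite restr_sum.
by apply: branch_superlinear => // i; exact: restr_ge0.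
Qed.

(** Under the product weights [\prod_y k y (Q y)] on maps [Q], the value of [Q] at
    [x] has law [k x]. *)
Lemma sum_product_weights (k : X -> M -> R) x m :
  (forall y, \sum_j k y j = 1) ->
  \sum_(Q : quantizer X M | Q x == m) \prod_y k y (Q y) = k x m.
Proof.
move=> k1.
pose k' y j := if (y == x) && (j != m) then 0 else k y j.
have kE (Q : quantizer X M) :
    \prod_y k' y (Q y) = if Q x == m then \prod_y k y (Q y) else 0.
  case: ifPn => Qx.
    apply: eq_bigr => y _; rewrite /k'; case: eqVneq => //= ->.
    by rewrite Qx.
  by rewrite (bigD1 x)//= {1}/k' eqxx Qx mul0r.
rewrite big_mkcond/=; under eq_bigr do rewrite -kE.
rewrite -bigA_distr_bigA/= (bigD1 x)//= [X in _ * X]big1 ?mulr1.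
  rewrite (bigD1 m)//= /k' !eqxx/= big1 ?addr0// => j jm.
  by rewrite jm.
by move=> y yx; rewrite -[RHS](k1 y); apply: eq_bigr => j _; rewrite /k' (negbTE yx).
Qed.

(** A randomised quantizer does not beat the deterministic ones.  Normalising the
    [nu m] pointwise gives, for each state [x], a distribution [k x] on the
    symbols; drawing the values [Q x] independently from [k x] writes every [nu m]
    as the same mixture over [Q] of the restrictions of [mu] to the cell of [m],
    and superlinearity moves the mixture out of the cost. *)
Lemma bellman_le_split F (nu : M -> meas) (u : M -> U) :
  superlinear F -> (forall m x, 0 <= nu m x) ->
  bellman F (\sum_m nu m) <= \sum_m branch F (u m) (nu m).
Proof.
move=> FS nu0; set mu := \sum_m nu m.
have muE x : mu x = \sum_m nu m x by rewrite /mu sum_ffunE.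
(* States without mass get an arbitrary distribution, here the one of [a0.1]. *)
pose k x m := if mu x == 0 then (m == a0.1 x)%:R else nu m x / mu x.
have mu_ge0 x : 0 <= mu x by rewrite muE; apply: sumr_ge0.
have k_ge0 x m : 0 <= k x m.
  by rewrite /k; case: ifP => // _; rewrite divr_ge0.
have k1 x : \sum_m k x m = 1.
  rewrite /k; case: (eqVneq (mu x) 0) => [_|mu0].
    rewrite (bigD1 (a0.1 x))//= eqxx big1 ?addr0// => m /negbTE ->//.
  by rewrite -mulr_suml -muE divff.
pose l (Q : quantizer X M) := \prod_y k y (Q y).
have l_ge0 Q : 0 <= l Q by apply: prodr_ge0.
have l1 : \sum_Q l Q = 1.
  by rewrite /l -bigA_distr_bigA/= big1.
have nuE m : nu m = \sum_Q l Q *: restr Q m mu.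
  apply/ffunP => x; rewrite sum_ffunE.
  transitivity (k x m * mu x).
    rewrite /k; case: eqVneq => [mux0|mux0]; last by rewrite divfK.
    rewrite mux0 mulr0; apply/eqP; move: mux0; rewrite muE => /eqP.
    by rewrite psumr_eq0// => /allP/(_ m (mem_index_enum _))/= /eqP ->.
  rewrite -(sum_product_weights x m k1) mulr_suml big_mkcond/=.
  apply: eq_bigr => Q _; rewrite scale_measE ffunE; case: ifP => // _.
  by rewrite mulr0.
(* The actions [u m] do not depend on the quantizer that is drawn. *)
pose eta : ctrl_map X U M := [ffun p => u p.2].
apply: (@le_trans _ _ (\sum_Q l Q * stage F mu (Q, eta))).
  rewrite -[leLHS]mul1r -l1 mulr_suml; apply: ler_sum => Q _.
  by rewrite ler_wpM2l// bellman_le.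
rewrite /stage; under eq_bigr do rewrite mulr_sumr.
rewrite exchange_big/=; apply: ler_sum => m _; rewrite [in leRHS]nuE.
under eq_bigr do rewrite ffunE/=.
by apply: branch_superlinear => // Q; exact: restr_ge0.
Qed.

(** With [e = 0] this is monotonicity; in general it is the contraction property
    for the norm weighted by the mass, in one-sided form. *)
Lemma bellman_contraction F G e :
  (forall mu, (forall x, 0 <= mu x) -> F mu <= G mu + e * mass mu) ->
  forall mu, (forall x, 0 <= mu x) ->
    bellman F mu <= bellman G mu + beta * e * mass mu.
Proof.
move=> FG mu mu0; apply: le_trans (bellman_le F mu (greedy G mu)) _.
rewrite /bellman; set a := greedy G mu.
rewrite /stage -(sum_mass_restr a.1 mu) mulr_sumr -big_split/=.
apply: ler_sum => m _; rewrite /branch -addrA lerD2l -mulrA -mulrDr.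
rewrite ler_wpM2l//; apply: le_trans (FG _ _) _; last by rewrite mass_push.
exact/push_ge0/restr_ge0.
Qed.

(** * The value function *)

(** The constant [D] solves [D = C + beta * D], where [C] bounds the running cost,
    so that the bound [D * mass] is reproduced by the Bellman operator. *)
Definition cost_bound : R := (\sum_x \sum_u `|c x u|) / (1 - beta).

Let D := cost_bound.

Lemma normr_cost_le x u : `|c x u| <= D * (1 - beta).
Proof.
have b1 : 1 - beta != 0 by rewrite subr_eq0 eq_sym lt_eqF//; case/andP: beta01.
rewrite /D /cost_bound divfK// (bigD1 x)//= (bigD1 u)//= -addrA lerDl.
by rewrite addr_ge0// sumr_ge0// => y _; rewrite sumr_ge0.
Qed.

Lemma cost_bound_ge0 : 0 <= D.
Proof.
rewrite /D /cost_bound divr_ge0//.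
  by apply: sumr_ge0 => x _; apply: sumr_ge0.
by rewrite subr_ge0 ltW//; case/andP: beta01.
Qed.

Definition bounded F :=
  forall mu, (forall x, 0 <= mu x) -> `|F mu| <= D * mass mu.

Lemma branch_bounded F u : bounded F -> bounded (branch F u).
Proof.
move=> FD mu mu0; rewrite /branch; apply: le_trans (ler_normD _ _) _.
have -> : D * mass mu = D * (1 - beta) * mass mu + beta * (D * mass mu) by ring.
rewrite lerD//.
  apply: le_trans (ler_norm_sum _ _ _) _.
  rewrite /mass mulr_sumr; apply: ler_sum => x _.
  by rewrite normrM (ger0_norm (mu0 x)) mulrC ler_wpM2r// normr_cost_le.
rewrite normrM (ger0_norm beta_ge0) ler_wpM2l//.
by rewrite -(mass_push u); apply/FD/push_ge0.
Qed.

Lemma bellman_bounded F : bounded F -> bounded (bellman F).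
Proof.
move=> FD mu mu0; rewrite /bellman /stage; set a := greedy F mu.
apply: le_trans (ler_norm_sum _ _ _) _.
rewrite -(sum_mass_restr a.1 mu) mulr_sumr; apply: ler_sum => m _.
exact/branch_bounded/restr_ge0.
Qed.

(** Starting from the lower bound [- (D * mass)], which is linear, makes all
    iterates superlinear; they increase to the fixed point. *)
Definition value_iter n : meas -> R := iter n bellman (fun mu => - (D * mass mu)).

Lemma value_iter_bounded n : bounded (value_iter n).
Proof.
elim: n => [|n IH]; last exact: bellman_bounded.
by move=> mu mu0; rewrite /= normrN ger0_norm// mulr_ge0 ?cost_bound_ge0 ?mass_ge0.
Qed.

Lemma value_iter_superlinear n : superlinear (value_iter n).
Proof.
elim: n => [|n IH]; last exact: bellman_superlinear.
move=> I l nu l0 nu0; rewrite /= mass_sum mulr_sumr -sumrN.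
by apply: ler_sum => i _; rewrite mulrN mulrCA.
Qed.

(** After [n] contractions the initial discrepancy, at most [2 * D * mass], is
    reduced by [beta ^+ n].  For [m = 0] the left-hand side is the lower bound
    itself. *)
Lemma value_iter_gap m n mu : (forall x, 0 <= mu x) ->
  value_iter m mu <= value_iter n mu + 2 * D * beta ^+ n * mass mu.
Proof.
elim: n m mu => [|n IH] m mu mu0.
  have /ler_normlP[_ H1] := value_iter_bounded m mu0.
  by rewrite /= expr0; lra.
case: m => [|m].
  have /ler_normlP[H1 _] := value_iter_bounded n.+1 mu0.
  rewrite -[value_iter 0 mu]/(- (D * mass mu)).
  have : 0 <= 2 * D * beta ^+ n.+1 * mass mu.
    have := cost_bound_ge0; have := mass_ge0 mu0 => ? ?.
    by apply: mulr_ge0 => //; apply: mulr_ge0; [exact: mulr_ge0 | exact: exprn_ge0].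
  by move: H1; move: (value_iter _ _) => v; lra.
rewrite exprS mulrCA.
by apply: bellman_contraction => // nu nu0; exact: IH.
Qed.

Definition value mu : R := sup (range (value_iter ^~ mu)).

Section value_bounds.
Context (mu : meas) (mu0 : forall x, 0 <= mu x).

Lemma value_iter_le n : value_iter n mu <= value mu.
Proof.
apply: ub_le_sup; last by exists n.
exists (D * mass mu) => _ [m _ <-].
by have /ler_normlP[] := value_iter_bounded m mu0.
Qed.

Lemma value_le_iter n :
  value mu <= value_iter n mu + 2 * D * mass mu * beta ^+ n.
Proof.
apply: ge_sup; first by exists (value_iter 0 mu), 0%N.
by move=> _ [m _ <-]; rewrite mulrAC; exact: value_iter_gap.
Qed.

End value_bounds.

Let beta_lt1 : 0 <= beta < 1. Proof. by case/andP: beta01 => /ltW -> ->. Qed.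

Lemma value_bounded : bounded value.
Proof.
move=> mu mu0; apply/ler_normlP; split.
  have := value_iter_le mu0 0; rewrite /=; lra.
apply: ge_sup; first by exists (value_iter 0 mu), 0%N.
by move=> _ [m _ <-]; have /ler_normlP[] := value_iter_bounded m mu0.
Qed.

(** Passes from the iterates to their supremum by the uniform geometric bound. *)
Lemma value_superlinear : superlinear value.
Proof.
move=> I l nu l0 nu0.
have s0 x : 0 <= (\sum_i l i *: nu i) x.
  by rewrite sum_ffunE sumr_ge0// => i _; rewrite scale_measE mulr_ge0.
apply: (@ler_geometric_gap _ beta (\sum_i l i * (2 * D * mass (nu i)))) => // n.
rewrite mulr_suml.
apply: (@le_trans _ _ (\sum_i l i * value_iter n (nu i) +
    \sum_i l i * (2 * D * mass (nu i)) * beta ^+ n)).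
  rewrite -big_split/=; apply: ler_sum => i _.
  by rewrite -mulrA -mulrDr ler_wpM2l// value_le_iter.
rewrite -mulr_suml lerD2r.
exact: le_trans (value_iter_superlinear n l0 nu0) (value_iter_le s0 n).
Qed.

(** Both inequalities compare [value] with an iterate, apply the Bellman operator
    once, and let the geometric error vanish. *)
Lemma value_bellman mu : (forall x, 0 <= mu x) -> value mu = bellman value mu.
Proof.
move=> mu0; apply/eqP; rewrite eq_le; apply/andP; split.
  apply: (@ler_geometric_gap _ beta (2 * D * mass mu * beta)) => // n.
  apply: le_trans (value_le_iter mu0 n.+1) _.
  rewrite exprS mulrA lerD2r.
  have := @bellman_contraction (value_iter n) value 0 _ mu mu0.
  rewrite mulr0 mul0r addr0; apply => nu nu0.
  by rewrite mul0r addr0; exact: value_iter_le.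
apply: (@ler_geometric_gap _ beta (beta * (2 * D) * mass mu)) => // n.
apply: (@le_trans _ _ (value_iter n.+1 mu + beta * (2 * D * beta ^+ n) * mass mu)).
  apply: (bellman_contraction _ mu0) => nu nu0.
  by rewrite mulrAC; exact: value_le_iter.
rewrite lerD//; first exact: value_iter_le.
by rewrite le_eqVlt; apply/orP; left; apply/eqP; ring.
Qed.

(** Superlinearity gives one inequality for every factor [s]; for [s != 0] the
    other one is the same statement for the factor [s^-1]. *)
Lemma valueZ s mu : 0 <= s -> (forall x, 0 <= mu x) ->
  value (s *: mu) = s * value mu.
Proof.
have val0 : value 0 = 0.
  have z0 x : 0 <= (0 : meas) x by rewrite ffunE.
  have := value_bounded z0.
  rewrite /mass big1 ?mulr0 ?normr_le0; first by move/eqP.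
  by move=> x _; rewrite ffunE.
have super t nu : 0 <= t -> (forall x, 0 <= nu x) ->
    t * value nu <= value (t *: nu).
  move=> t0 nu0.
  have := @value_superlinear unit (fun=> t) (fun=> nu).
  by rewrite !big_const card_unit !iterS /= !addr0; apply.
move=> s0 mu0; have [->|sN0] := eqVneq s 0; first by rewrite scale0r mul0r.
apply/eqP; rewrite eq_le super// andbT.
have sp : 0 < s by rewrite lt_neqAle eq_sym sN0.
rewrite -[leLHS](mulVKf sN0) ler_pM2l//.
rewrite -[in leRHS](scalerK sN0 mu).
apply: super; first by rewrite invr_ge0.
by move=> x; rewrite scale_measE mulr_ge0.
Qed.

Lemma stageZ s mu a : 0 <= s -> (forall x, 0 <= mu x) ->
  stage value (s *: mu) a = s * stage value mu a.
Proof.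
move=> s0 mu0; rewrite /stage mulr_sumr; apply: eq_bigr => m _.
rewrite restrZ /branch pushZ valueZ//; last exact/push_ge0/restr_ge0.
rewrite mulrDr mulrCA; congr (_ + _); rewrite mulr_sumr.
by apply: eq_bigr => x _; rewrite scale_measE mulrA.
Qed.

(** A minimiser at the normalised measure is still one after rescaling, so it is
    enough to choose decisions as functions of the predictor. *)
Lemma value_greedy s mu : 0 <= s -> (forall x, 0 <= mu x) ->
  value (s *: mu) = stage value (s *: mu) (greedy value mu).
Proof.
by move=> s0 mu0; rewrite valueZ// stageZ// (value_bellman mu0).
Qed.

End dynamic_programming.

(** * Cost to go along histories *)

Section cost_to_go.
Context (R : realType) (X U M : finType).
Context (K : X -> U -> X -> R) (c : X -> U -> R) (beta : R).
Hypothesis K_ge0 : forall x u x', 0 <= K x u x'.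
Hypothesis K_sum1 : forall x u, \sum_x' K x u x' = 1.
Hypothesis beta01 : 0 < beta < 1.
Context (a0 : quantizer X M * ctrl_map X U M).

Let beta_ge0 : 0 <= beta. Proof. by case/andP: beta01 => /ltW. Qed.

Local Notation V := (value K c beta a0).
Local Notation D := (cost_bound c beta).

Definition extend (g : adm_policy X U M) t (h : history X U M t) (x' : X) :
    history X U M t.+1 :=
  History [tuple of rcons (hist_x h) x'] (hist_symbols g h)
          [tuple of rcons (hist_u h) (hist_action g h)].

Definition symbol (g : adm_policy X U M) t (h : history X U M t) : M :=
  adm_enc g (hist_x h) (hist_q h).

Lemma hist_state_extend g t (h : history X U M t) x' :
  hist_state (extend g h x') = x'.
Proof.
by rewrite /hist_state /= (tnth_nth x')/= nth_rcons size_tuple ltnn eqxx.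
Qed.

(** Expected discounted cost over the next [N] stages when the history is [h] and
    the noise to come is integrated out. *)
Fixpoint cost_to_go (g : adm_policy X U M) N t (h : history X U M t) : R :=
  if N is N'.+1 then
    let x := hist_state h in
    let u := hist_action g h in
    c x u + beta * \sum_x' K x u x' * cost_to_go g N' (extend g h x')
  else 0.

(** A measure on histories is given as a finite family of histories [h i] with
    weights [r i], possibly with repetitions; [law] is the induced measure on the
    current state. *)
Definition law t (I : finType) (r : I -> R) (h : I -> history X U M t) :
    {ffun X -> R} :=
  [ffun x => \sum_(i | hist_state (h i) == x) r i].

(** The histories of positive weight share what the controller knows, namely the
    symbols [s] and the actions [v]; the action chosen after the next symbol [m]
    is then a function of [m] only. *)
Section families.
Context (g : adm_policy X U M) (t : nat).

Context (I : finType) (r : I -> R) (h : I -> history X U M t).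
Context (s : t.-tuple M) (v : t.-tuple U).
Hypothesis r_ge0 : forall i, 0 <= r i.
Hypothesis r_info : forall i, r i != 0 -> hist_q (h i) = s /\ hist_u (h i) = v.

Definition next_action (m : M) : U := adm_ctl g [tuple of rcons s m] v.

Definition send (m : M) (i : I) : R := if symbol g (h i) == m then r i else 0.

Definition next_weight (m : M) (p : I * X) : R :=
  send m p.1 * K (hist_state (h p.1)) (next_action m) p.2.

Definition next_history (p : I * X) : history X U M t.+1 := extend g (h p.1) p.2.

Lemma sum_law (F : X -> R) :
  \sum_x law r h x * F x = \sum_i r i * F (hist_state (h i)).
Proof.
under eq_bigr do rewrite ffunE mulr_suml.
rewrite (exchange_big_dep xpredT)//=; apply: eq_bigr => i _.
by rewrite (big_pred1 (hist_state (h i)))// => x; rewrite eq_sym.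
Qed.

Lemma law_ge0 x : 0 <= law r h x.
Proof. by rewrite ffunE sumr_ge0. Qed.

Lemma send_ge0 m i : 0 <= send m i.
Proof. by rewrite /send; case: ifP. Qed.

Lemma next_weight_ge0 m p : 0 <= next_weight m p.
Proof. by rewrite mulr_ge0// send_ge0. Qed.

Lemma next_info m p : next_weight m p != 0 ->
  hist_q (next_history p) = [tuple of rcons s m] /\
  hist_u (next_history p) = [tuple of rcons v (next_action m)].
Proof.
rewrite /next_weight /send mulf_eq0 negb_or => /andP[].
case: ifP => [/eqP hm|_]; last by rewrite eqxx.
move=> /r_info[hs hv] _.
have qE : hist_symbols g (h p.1) = [tuple of rcons s m].
  by apply: val_inj; rewrite /= -/(symbol g (h p.1)) hm hs.
split=> //; apply: val_inj; rewrite /= hv; congr rcons.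
by rewrite /hist_action qE hv.
Qed.

Lemma sum_law_send : \sum_m law (send m) h = law r h.
Proof.
apply/ffunP => x; rewrite sum_ffunE ffunE.
under eq_bigr do rewrite ffunE.
rewrite exchange_big/=; apply: eq_bigr => i _; rewrite /send.
by rewrite -big_mkcond/= (big_pred1 (symbol g (h i)))// => m; rewrite eq_sym.
Qed.

End families.

Section step.
Context (g : adm_policy X U M) (t : nat).
Context (I : finType) (r : I -> R) (h : I -> history X U M t).
Context (s : t.-tuple M) (v : t.-tuple U).
Hypothesis r_ge0 : forall i, 0 <= r i.
Hypothesis r_info : forall i, r i != 0 -> hist_q (h i) = s /\ hist_u (h i) = v.

Local Notation act := (next_action g s v).
Local Notation nu m := (law (send g r h m) h).
Local Notation nw m := (next_weight g r h s v m).
Local Notation nh := (next_history g h).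

Lemma law_next m : law (nw m) nh = push K (act m) (nu m).
Proof.
apply/ffunP => x'; rewrite [RHS]ffunE.
under [RHS]eq_bigr do rewrite mulrC.
rewrite sum_law ffunE /next_history.
under eq_bigl do rewrite hist_state_extend.
rewrite (reindex_onto (fun i => (i, x')) fst)/=.
  by apply: eq_big => [i|i _]; rewrite ?eqxx.
by case=> i x /= /eqP ->.
Qed.

(** Splits the family according to the next symbol [m], and each part according
    to the next state. *)
Lemma cost_to_go_step N :
  \sum_i r i * cost_to_go g N.+1 (h i) =
  \sum_m (\sum_x nu m x * c x (act m) +
          beta * \sum_p nw m p * cost_to_go g N (nh p)).
Proof.
transitivity (\sum_i \sum_m send g r h m i * cost_to_go g N.+1 (h i)).
  apply: eq_bigr => i _; rewrite -mulr_suml /send; congr (_ * _).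
  by rewrite -big_mkcond/= (big_pred1 (symbol g (h i)))// => m; rewrite eq_sym.
rewrite exchange_big/=; apply: eq_bigr => m _.
rewrite sum_law mulr_sumr.
have -> : \sum_p beta * (nw m p * cost_to_go g N (nh p)) =
    \sum_i \sum_x' beta * (nw m (i, x') * cost_to_go g N (nh (i, x'))).
  by rewrite pair_bigA; apply: eq_bigr => -[].
rewrite -big_split/=; apply: eq_bigr => i _.
have [s0|sN0] := eqVneq (send g r h m i) 0.
  rewrite s0 !mul0r add0r big1// => x' _.
  by rewrite /next_weight/= s0 !mul0r mulr0.
have uE : hist_action g (h i) = act m.
  move: sN0; rewrite /send; case: ifP => [/eqP hm|_]; last by rewrite eqxx.
  move=> /r_info[hs hv]; rewrite /hist_action /next_action hv; congr (adm_ctl _ _ _).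
  by apply: val_inj; rewrite /= -/(symbol g (h i)) hm hs.
rewrite uE mulrDr; congr (_ + _); rewrite mulrCA mulr_sumr mulr_sumr.
by apply: eq_bigr => x' _; rewrite /next_weight/= !mulrA.
Qed.

End step.

(** Each step splits the law as [bellman_le_split] allows; the information of the
    controller stays common to each part, so the induction goes on.  After [N]
    steps the neglected continuation is bounded by [D * mass]. *)
Lemma cost_to_go_ge_value g N : forall t (I : finType) (r : I -> R)
    (h : I -> history X U M t) s v,
  (forall i, 0 <= r i) ->
  (forall i, r i != 0 -> hist_q (h i) = s /\ hist_u (h i) = v) ->
  V (law r h) <= \sum_i r i * cost_to_go g N (h i) + D * mass (law r h) * beta ^+ N.
Proof.
elim: N => [|N IH] t I r h s v r0 rsv.
  rewrite big1 => [|i _]; last by rewrite /= mulr0.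
  rewrite add0r expr0 mulr1.
  by have /ler_normlP[] := value_bounded c K_ge0 K_sum1 beta01 a0 (law_ge0 h r0).
rewrite (cost_to_go_step g rsv) value_bellman//; last exact: law_ge0.
rewrite -{1}(sum_law_send g r h).
pose u m := next_action g s v m.
have VS := value_superlinear c K_ge0 K_sum1 beta01 a0.
apply: le_trans (bellman_le_split c K_ge0 beta01 a0 u VS _) _.
  by move=> m; apply/law_ge0/send_ge0.
have -> : D * mass (law r h) * beta ^+ N.+1 =
    \sum_m beta * (D * mass (law (send g r h m) h) * beta ^+ N).
  rewrite -mulr_sumr -mulr_suml -mulr_sumr exprS mulrCA; congr (_ * (_ * _ * _)).
  rewrite -(sum_law_send g r h) /mass exchange_big/=.
  by apply: eq_bigr => x _; rewrite sum_ffunE.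
rewrite -big_split/=; apply: ler_sum => m _; rewrite /branch -addrA lerD2l -mulrDr.
rewrite ler_wpM2l// -(mass_push K_sum1 (u m)) -law_next.
apply: (IH _ _ _ _ [tuple of rcons s m] [tuple of rcons v (u m)]).
  exact: next_weight_ge0.
by move=> p; apply: next_info.
Qed.

Section stationary.
Context (pi0 : pmeas R X).
Context (ge : pmeas R X -> quantizer X M) (gc : pmeas R X -> ctrl_map X U M).

Local Notation g := (cp_policy K pi0 (fun=> ge) (fun=> gc)).
Local Notation pred := (predictor K pi0 (fun=> ge) (fun=> gc)).

Lemma predictor_rcons s m :
  pred (rcons s m) = predictor_step K (ge (pred s)) (gc (pred s)) m (pred s).
Proof.
by rewrite /predictor; elim: s 0%N pi0 => [|q s IH] t pi //=.
Qed.

Lemma pmeas_ge0 (pi : pmeas R X) x : 0 <= pi x.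
Proof. by case: pi => p /= /andP[/forallP]. Qed.

Lemma mass_pmeas (pi : pmeas R X) : mass pi = 1.
Proof. by case: pi => p /= /andP[_ /eqP]. Qed.

(** The predictor update is the linear update followed by normalisation.  When the
    symbol has probability zero both sides vanish, whatever the update is. *)
Lemma predictor_stepE (Q : quantizer X M) (eta : ctrl_map X U M) m (pi : pmeas R X) :
  push K (eta (Q, m)) (restr Q m pi) =
  mass (restr Q m pi) *: (predictor_step K Q eta m pi : {ffun X -> R}).
Proof.
have r0 : forall x, 0 <= restr Q m pi x by apply: restr_ge0; exact: pmeas_ge0.
have mE : \sum_(x | Q x == m) pi x = mass (restr Q m pi).
  by rewrite big_mkcond; apply: eq_bigr => x _; rewrite ffunE.
have pE x' : \sum_(x | Q x == m) K x (eta (Q, m)) x' * pi x =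
    push K (eta (Q, m)) (restr Q m pi) x'.
  rewrite ffunE big_mkcond; apply: eq_bigr => x _; rewrite ffunE.
  by case: ifP => // _; rewrite mulr0.
have [m0|mN0] := eqVneq (mass (restr Q m pi)) 0.
  rewrite m0 scale0r; apply/ffunP => x; rewrite [RHS]ffunE.
  have := mass_push K_sum1 (eta (Q, m)) (restr Q m pi); rewrite m0 => /eqP.
  rewrite /mass psumr_eq0 => [/allP/(_ x (mem_index_enum _))/eqP//|y _].
  exact: push_ge0.
have mp : 0 <= mass (restr Q m pi) by exact: mass_ge0.
have stepE : [ffun x' => (\sum_(x | Q x == m) pi x)^-1 *
      \sum_(x | Q x == m) K x (eta (Q, m)) x' * pi x] =
    (mass (restr Q m pi))^-1 *: push K (eta (Q, m)) (restr Q m pi).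
  by apply/ffunP => x; rewrite scale_measE ffunE mE pE.
rewrite /predictor_step stepE val_insubd ifT ?scalerKV//.
apply/andP; split.
  apply/forallP => x; rewrite scale_measE mulr_ge0 ?invr_ge0//.
  exact: push_ge0.
by rewrite -/(mass _) massZ mass_push// mulVf.
Qed.

Hypothesis ge_gc_greedy : forall t (s : t.-tuple M),
  (ge (pred s), gc (pred s)) = greedy K c beta a0 V (pred s).

(** For a policy driven by the predictor the symbol is a function [Q] of the state,
    the parts are the restrictions of the law to the cells of [Q], and the law
    stays proportional to the predictor.  The Bellman equation then holds with
    equality at every step. *)
Lemma cost_to_go_greedy_le N : forall t (I : finType) (r : I -> R)
    (h : I -> history X U M t) s v k,
  (forall i, 0 <= r i) ->
  (forall i, r i != 0 -> hist_q (h i) = s /\ hist_u (h i) = v) ->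
  0 <= k -> law r h = k *: (pred s : {ffun X -> R}) ->
  \sum_i r i * cost_to_go g N (h i) <= V (law r h) + D * mass (law r h) * beta ^+ N.
Proof.
elim: N => [|N IH] t I r h s v k r0 rsv k0 lawE.
  rewrite big1 => [|i _]; last by rewrite /= mulr0.
  rewrite expr0 mulr1 -lerBlDr sub0r.
  have /ler_normlP[+ _] := value_bounded c K_ge0 K_sum1 beta01 a0 (law_ge0 h r0).
  lra.
rewrite (cost_to_go_step g rsv).
set Q := ge (pred s); set eta := gc (pred s).
have actE m : next_action g s v m = eta (Q, m).
  have takeE : take t (rcons s m) = s.
    by rewrite -cats1 take_size_cat ?size_tuple.
  rewrite /next_action /= takeE.
  by rewrite (tnth_nth m)/= nth_rcons size_tuple ltnn eqxx.
have lawQ m : law (send g r h m) h = restr Q m (law r h).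
  apply/ffunP => x; rewrite !ffunE [in LHS]/send.
  rewrite -[RHS](_ : \sum_(i | hist_state (h i) == x)
      (if Q x == m then r i else 0) = _).
    apply: eq_bigr => i /eqP <-.
    have [->|/rsv[qs _]] := eqVneq (r i) 0; first by rewrite !if_same.
    by rewrite /symbol/= qs.
  by case: ifP => // _; rewrite big1.
under eq_bigr do rewrite lawQ actE.
have -> : V (law r h) = \sum_m branch K c beta V (eta (Q, m)) (restr Q m (law r h)).
  rewrite lawE [LHS]value_greedy//; last exact: pmeas_ge0.
  by rewrite -ge_gc_greedy.
have -> : D * mass (law r h) * beta ^+ N.+1 =
    \sum_m beta * (D * mass (restr Q m (law r h)) * beta ^+ N).
  by rewrite -mulr_sumr -mulr_suml -mulr_sumr sum_mass_restr exprS mulrCA.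
rewrite -big_split/=; apply: ler_sum => m _.
rewrite /branch -addrA lerD2l -mulrDr ler_wpM2l//.
rewrite -(mass_push K_sum1 (eta (Q, m))) -lawQ -actE -law_next.
apply: (IH _ _ _ _ [tuple of rcons s m] [tuple of rcons v (next_action g s v m)]
  (k * mass (restr Q m (pred s)))).
- exact: next_weight_ge0.
- by move=> p; apply: next_info.
- by rewrite mulr_ge0// mass_ge0//; apply: restr_ge0; exact: pmeas_ge0.
rewrite law_next lawQ actE lawE restrZ pushZ predictor_stepE scalerA.
by rewrite [X in pred X]/= predictor_rcons.
Qed.

End stationary.
End cost_to_go.

(** * The law of the controlled process *)

Section history_fintype.
Context (X U M : finType) (t : nat).

Definition history_triple (h : history X U M t) :=
  (hist_x h, hist_q h, hist_u h).

Definition triple_history (p : t.+1.-tuple X * t.-tuple M * t.-tuple U) :=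
  History p.1.1 p.1.2 p.2.

Lemma history_tripleK : cancel history_triple triple_history.
Proof. by case. Qed.

HB.instance Definition _ :=
  Finite.copy (history X U M t) (can_type history_tripleK).

End history_fintype.

Lemma extend_inj (X U M : finType) (g : adm_policy X U M) t
    (h h' : history X U M t) x x' :
  extend g h x = extend g h' x' -> h = h' /\ x = x'.
Proof.
case: h h' => [a b e] [a' b' e'].
move=> E; have := congr1 (fun h => val (hist_x h)) E.
have := congr1 (fun h => val (hist_q h)) E.
have := congr1 (fun h => val (hist_u h)) E => /=.
move=> /rcons_inj[/val_inj -> _] /rcons_inj[/val_inj -> _].
by move=> /rcons_inj[/val_inj -> ->].
Qed.

Section finite_random_element.
Context d (Om : measurableType d) (R : realType) (P : probability Om R).
Context (H : finType) (Y : Om -> H).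
Hypothesis Y_meas : forall h, measurable (Y @^-1` [set h]).
Implicit Types phi : H -> R.

Let phiE phi : (fun o => (phi (Y o))%:E) =
  (fun o => \sum_h (phi h)%:E * (\1_(Y @^-1` [set h]) o)%:E)%E.
Proof.
apply/funext => o; rewrite (bigD1 (Y o))//= big1 => [|h hY].
  by rewrite indicE mem_set// mule1 adde0.
rewrite indicE memNset ?mule0// => /= E.
by rewrite E eqxx in hY.
Qed.

Let indic_int phi h :
  P.-integrable setT (fun o => (phi h)%:E * (\1_(Y @^-1` [set h]) o)%:E)%E.
Proof. by apply: integrableZl => //; exact: integrable_indic. Qed.

Lemma integrable_finite phi : P.-integrable setT (fun o => (phi (Y o))%:E).
Proof. by rewrite phiE; apply: integrable_sum => //= h _. Qed.

Lemma integral_finite phi :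
  (\int[P]_o (phi (Y o))%:E)%E =
  (\sum_h fine (P (Y @^-1` [set h])) * phi h)%:E.
Proof.
rewrite (phiE phi) -sumEFin.
rewrite integral_sum//; apply: eq_bigr => h _.
rewrite integralZl//; last exact: integrable_indic.
rewrite integral_indic// setIT EFinM muleC fineK// fin_num_measure//.
Qed.

End finite_random_element.

Section controlled_process.
Context (R : realType) (X U M : finType).
Context d (Om : measurableType d) (P : probability Om R).
Context d' (W : measurableType d') (f : X -> U -> W -> X).
Hypothesis f_meas : forall x u x', measurable [set v | f x u v = x'].
Context (x0 : Om -> X).
Hypothesis x0_meas : forall x, measurable (x0 @^-1` [set x]).
Context (w : nat -> {mfun Om >-> W}).
Hypothesis w_id : identically_distributed P w.
Hypothesis w_indep : mutually_independent P w.
Hypothesis x0_w_indep : independent_of_process P x0 w.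
Context (c : X -> U -> R) (beta : R) (g : adm_policy X U M).

Local Notation K := (transition P f w).

Definition run_at t (o : Om) : history X U M t := run f g (x0 o) (w ^~ o) t.

Definition hist_event t (h : history X U M t) : set Om := run_at t @^-1` [set h].

Definition hist_prob t (h : history X U M t) : R := fine (P (hist_event h)).

Definition initial_history (x : X) : history X U M 0 :=
  History [tuple x] [tuple] [tuple].

Lemma transition_ge0 x u x' : 0 <= K x u x'.
Proof. exact: fine_ge0. Qed.

Lemma noise_law t (B : set W) : measurable B ->
  P (w t @^-1` B) = P (w 0%N @^-1` B).
Proof. exact: w_id. Qed.

Lemma noise_preimage_measurable t (B : set W) :
  measurable B -> measurable (w t @^-1` B).
Proof. by move=> mB; rewrite -[X in measurable X]setTI; exact: measurable_funP. Qed.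

Lemma transition_sum1 x u : \sum_x' K x u x' = 1.
Proof.
have mY x' : measurable ((fun o => f x u (w 0%N o)) @^-1` [set x']).
  exact: (noise_preimage_measurable 0 (f_meas x u x')).
have := integral_finite P mY (fun=> 1).
rewrite /= integral_cst//= mul1e probability_setT => -[->].
by apply: eq_bigr => y _; rewrite mulr1.
Qed.

Lemma hist_event_extend t (h : history X U M t) x' :
  hist_event (extend g h x') =
  hist_event h `&`
    w t @^-1` [set v | f (hist_state h) (hist_action g h) v = x'].
Proof.
apply/seteqP; split => o /=.
  by rewrite /hist_event/= => /extend_inj[] <- <-.
by rewrite /hist_event/= => -[<- <-].
Qed.

(** Histories whose symbols or actions do not follow the policy never occur. *)
Lemma hist_event_dead t (h : history X U M t.+1) :
  (forall h' x', h <> extend g h' x') -> hist_event h = set0.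
Proof. by move=> hN; rewrite -subset0 => o /= /esym; exact: hN. Qed.

Lemma hist_event_measurable t (h : history X U M t) : measurable (hist_event h).
Proof.
elim: t h => [|t IH] h.
  have [[x ->]|hN] := pselect (exists x, h = initial_history x).
    rewrite [X in measurable X](_ : _ = x0 @^-1` [set x])//.
    apply/seteqP; split => o /=; first by case.
    by move=> ox; rewrite /hist_event/=/run_at/= ox.
  rewrite [X in measurable X](_ : _ = set0)//.
  by rewrite -subset0 => o /= oh; apply: hN; exists (x0 o).
have [[h' [x' ->]]|hN] := pselect (exists h' x', h = extend g h' x').
  rewrite hist_event_extend; apply: measurableI => //.
  exact: noise_preimage_measurable.
rewrite hist_event_dead// => h' x' hE.
by apply: hN; exists h', x'.
Qed.

Lemma noise_event (s : seq nat) (B : nat -> set W) :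
  (forall t, measurable (B t)) ->
  process_events w (\bigcap_(t in [set` s]) (w t @^-1` B t)).
Proof.
move=> mB.
pose G := [set E | exists t B, measurable B /\ E = w t @^-1` B].
apply: (@fin_bigcap_measurable _ (g_sigma_algebraType G)) => //.
by move=> t _; apply: sub_sigma_algebra; exists t, (B t).
Qed.

(** Unfolding the last transition turns the event of a history of length [t.+1]
    into the event of its prefix together with a condition on the noise at time
    [t]; this condition joins those on the later noise, and the induction ends
    with the independence of the initial state from the noise. *)
Lemma hist_future_indep t (h : history X U M t) (s : seq nat) (B : nat -> set W) :
  uniq s -> all (leq t) s -> (forall j, measurable (B j)) ->
  P (hist_event h `&` \bigcap_(j in [set` s]) (w j @^-1` B j)) =
  (P (hist_event h) * \prod_(j <- s) P (w j @^-1` B j))%E.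
Proof.
elim: t h s B => [|t IH] h s B us st mB.
  have -> : hist_event h = x0 @^-1` [set x | initial_history x = h] by [].
  by rewrite x0_w_indep ?w_indep//; exact: noise_event.
have [[h' [x' ->]]|hN] := pselect (exists h' x', h = extend g h' x'); last first.
  rewrite hist_event_dead ?set0I ?measure0 ?mul0e// => h' x' hE.
  by apply: hN; exists h', x'.
rewrite hist_event_extend; set C := [set v | _].
have mC : measurable C by exact: f_meas.
have ts : t \notin s.
  by apply/negP => /(allP st); rewrite ltnn.
(* The condition on the noise at time [t] is added to the family [B]. *)
pose B' j := if j == t then C else B j.
have mB' j : measurable (B' j) by rewrite /B'; case: ifP.
have B'E j : j \in s -> B' j = B j.
  by rewrite /B'; case: eqP => // -> tis; rewrite tis in ts.
have B't : B' t = C by rewrite /B' eqxx.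
have capE (r : seq nat) : \bigcap_(j in [set` t :: r]) (w j @^-1` B' j) =
    w t @^-1` C `&` \bigcap_(j in [set` r]) (w j @^-1` B' j).
  by rewrite !bigcap_seq big_cons B't.
have IHs := IH h' (t :: s) B' _ _ mB'.
have IHt := IH h' [:: t] B' _ _ mB'.
rewrite !capE big_cons B't in IHs; rewrite capE big_cons big_nil B't mule1 in IHt.
rewrite bigcap_seq big_nil setIT in IHt.
rewrite IHt//= ?leqnn// -muleA.
have -> : \bigcap_(j in [set` s]) (w j @^-1` B j) =
    \bigcap_(j in [set` s]) (w j @^-1` B' j).
  by apply: eq_bigcapr => j /= js; rewrite B'E.
rewrite -setIA IHs/= ?ts ?leqnn//=; last first.
  by apply: sub_all st => j /ltnW.
congr (_ * (_ * _))%E; rewrite big_seq [RHS]big_seq.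
by apply: eq_bigr => j js; rewrite B'E.
Qed.

Lemma hist_prob_extend t (h : history X U M t) x' :
  hist_prob (extend g h x') =
  hist_prob h * K (hist_state h) (hist_action g h) x'.
Proof.
rewrite /hist_prob hist_event_extend; set C := [set v | _].
have mC : measurable C by exact: f_meas.
have := @hist_future_indep t h [:: t] (fun=> C).
rewrite bigcap_seq !big_cons !big_nil setIT mule1 => -> //=; last by rewrite leqnn.
rewrite fineM ?fin_num_measure//; first by rewrite noise_law.
- exact: hist_event_measurable.
- exact: noise_preimage_measurable.
Qed.

Lemma integral_run t (phi : history X U M t -> R) :
  (\int[P]_o (phi (run_at t o))%:E)%E = (\sum_h hist_prob h * phi h)%:E.
Proof. exact/integral_finite/hist_event_measurable. Qed.

(** Computes the expectation of [phi] at time [t.+1] from the joint law of the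
    history at time [t] and of the next state. *)
Lemma mean_run_step t (phi : history X U M t.+1 -> R) :
  \sum_h hist_prob h * phi h =
  \sum_h hist_prob h *
    \sum_x' K (hist_state h) (hist_action g h) x' * phi (extend g h x').
Proof.
pose Y o := (run_at t o, hist_state (run_at t.+1 o)).
have YE p : Y @^-1` [set p] = hist_event (extend g p.1 p.2).
  case: p => h x; apply/seteqP; split => o; rewrite /hist_event /Y /=.
    by case=> <- <-; rewrite hist_state_extend.
  by move=> /extend_inj[<- <-]; rewrite hist_state_extend.
have mY p : measurable (Y @^-1` [set p]) by rewrite YE; exact: hist_event_measurable.
apply: EFin_inj; rewrite -integral_run.
have -> : (fun o => (phi (run_at t.+1 o))%:E) =
    (fun o => ((fun p => phi (extend g p.1 p.2)) (Y o))%:E).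
  by apply/funext => o; rewrite /Y /= hist_state_extend.
rewrite (integral_finite P mY (fun p => phi (extend g p.1 p.2))); congr EFin.
transitivity (\sum_h \sum_x' fine (P (Y @^-1` [set (h, x')])) * phi (extend g h x')).
  by rewrite pair_bigA/=; apply: eq_bigr => -[].
apply: eq_bigr => h _; rewrite mulr_sumr; apply: eq_bigr => x' _.
by rewrite YE -/(hist_prob _) hist_prob_extend mulrA.
Qed.

Definition mean_cost t : R :=
  \sum_(h : history X U M t) hist_prob h * c (hist_state h) (hist_action g h).

Lemma mean_cost_to_go N t :
  \sum_(h : history X U M t) hist_prob h * cost_to_go K c beta g N h =
  \sum_(k < N) beta ^+ k * mean_cost (t + k).
Proof.
elim: N t => [|N IH] t.
  by rewrite big_ord0 big1// => h _; rewrite mulr0.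
rewrite big_ord_recl expr0 mul1r addn0.
under [X in _ + X]eq_bigr do rewrite /= /bump /= ?add1n addnS -addSn exprS -mulrA.
rewrite -mulr_sumr -IH mean_run_step mulr_sumr /mean_cost -big_split/=.
by apply: eq_bigr => h _; rewrite mulrDr mulrCA.
Qed.

Lemma expected_cost N :
  'E_P[fun o => (\sum_(k < N) beta ^+ k *
      c (state f x0 w g k o) (action f x0 w g k o))%R]%E =
  (\sum_(k < N) beta ^+ k * mean_cost k)%:E.
Proof.
rewrite unlock -sumEFin; under eq_integral do rewrite -sumEFin.
pose phi k (h : history X U M k) := beta ^+ k * c (hist_state h) (hist_action g h).
rewrite (@integral_sum _ _ _ P setT _ 'I_N (fun k o => (phi k (run_at k o))%:E))//; last first.
  by move=> k; apply: integrable_finite; exact: hist_event_measurable.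
apply: eq_bigr => k _; rewrite integral_run; congr EFin.
by rewrite /mean_cost mulr_sumr; apply: eq_bigr => h _; rewrite mulrCA.
Qed.

Lemma mean_initial (pi0 : pmeas R X) (phi : history X U M 0 -> R) :
  (forall x, P (x0 @^-1` [set x]) = (pi0 x)%:E) ->
  \sum_h hist_prob h * phi h = \sum_x pi0 x * phi (initial_history x).
Proof.
move=> x0_law; apply: EFin_inj; rewrite -integral_run.
rewrite (integral_finite P x0_meas (fun x => phi (initial_history x))).
by congr EFin; apply: eq_bigr => x _; rewrite x0_law.
Qed.

Lemma mean_cost_le t : `|mean_cost t| <= \sum_x \sum_u `|c x u|.
Proof.
have p1 : \sum_(h : history X U M t) hist_prob h = 1.
  have := integral_run (fun _ : history X U M t => 1).
  rewrite /= integral_cst//= mul1e probability_setT => -[->].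
  by apply: eq_bigr => y _; rewrite mulr1.
apply: le_trans (ler_norm_sum _ _ _) _.
rewrite -[leRHS]mul1r -p1 mulr_suml; apply: ler_sum => h _.
have p0 : 0 <= hist_prob h by exact: fine_ge0.
rewrite normrM (ger0_norm p0) ler_wpM2l//.
rewrite (bigD1 (hist_state h))//= (bigD1 (hist_action g h))//= -addrA lerDl.
by rewrite addr_ge0// sumr_ge0// => y _; rewrite sumr_ge0.
Qed.

(** The expected costs are bounded, so the series is dominated by a geometric
    one and the limit defining the discounted cost is finite. *)
Lemma discounted_costE : 0 < beta < 1 ->
  exists2 J : R, discounted_cost P f x0 w c beta g = J%:E &
    (fun N => \sum_(k < N) beta ^+ k * mean_cost k) @ \oo --> J.
Proof.
move=> /andP[b0 b1].
set C := \sum_x \sum_u `|c x u|.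
have C0 : 0 <= C by apply: sumr_ge0 => x _; apply: sumr_ge0.
have cv : cvgn (series (fun k => beta ^+ k * mean_cost k)).
  apply: normed_cvg.
  apply: (series_le_cvg (v_ := geometric C beta)) => [k|k|k|].
  - exact: normr_ge0.
  - by rewrite /geometric/= mulr_ge0// exprn_ge0// ltW.
  - have bk : 0 <= beta ^+ k by rewrite exprn_ge0// ltW.
    rewrite /geometric/= normrM (ger0_norm bk) [leLHS]mulrC.
    by apply: ler_wpM2r => //; exact: mean_cost_le.
  - by apply: is_cvg_geometric_series; rewrite ger0_norm// ltW.
have sE : series (fun k => beta ^+ k * mean_cost k) =
    (fun N => \sum_(k < N) beta ^+ k * mean_cost k).
  by apply/funext => N; rewrite /series/= big_mkord.
rewrite sE in cv; exists (limn (fun N => \sum_(k < N) beta ^+ k * mean_cost k)) => //.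
rewrite /discounted_cost; under eq_fun do rewrite expected_cost.
by rewrite EFin_lim.
Qed.

End controlled_process.

(** * Borel selectors *)

Section borel_selectors.
Context (R : realType) (X : finType).

Local Notation borel := <<s [set O : set (weak_pmeas R X) | open O] >>.

Lemma pmeas_integral_inj : injective (@pmeas_integral R X).
Proof.
move=> pi rho E; apply: val_inj; apply/ffunP => x.
have := congr1 (@^~ (fun y => (y == x)%:R)) E.
rewrite /pmeas_integral/= !(bigD1 x (P := xpredT))//= eqxx !mulr1.
by rewrite !big1 ?addr0// => y /negbTE ->; rewrite mulr0.
Qed.

(** The map [pmeas_integral] is continuous and injective into a Hausdorff space,
    so singletons are closed. *)
Lemma borel_set1 (pi : pmeas R X) : borel [set pi].
Proof.
have cl : closed ([set pi] : set (weak_pmeas R X)).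
  have -> : [set pi] = @pmeas_integral R X @^-1` [set pmeas_integral pi].
    by apply/seteqP; split => rho /= => [->|/pmeas_integral_inj].
  apply: closed_comp => [rho _|]; first exact: initial_continuous.
  apply: accessible_closed_set1; apply: hausdorff_accessible.
  by apply: hausdorff_product => g; exact: Rhausdorff.
rewrite -[X in borel X]setCK -setTD; apply: sigma_algebraCD.
by apply: sub_sigma_algebra; exact: closed_openC.
Qed.

Lemma borel_countable (S : set (pmeas R X)) : countable S -> borel S.
Proof.
move=> /countable_injP[i i_inj].
have -> : S = \bigcup_n (S `&` i @^-1` [set n]).
  by apply/seteqP; split => [pi Spi|pi [n _ []]//]; exists (i pi).
apply: (@sigma_algebra_bigcup _ setT _ (fun n => S `&` i @^-1` [set n])) => n.
have [[pi [Spi ipi]]|N] := pselect (exists pi, S pi /\ i pi = n).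
  rewrite (_ : _ `&` _ = [set pi]); first exact: borel_set1.
  apply/seteqP; split => rho /= => [[Srho irho]|->//].
  by apply: i_inj; rewrite ?inE// irho ipi.
rewrite (_ : _ `&` _ = set0); first exact: sigma_algebra0.
by rewrite -subset0 => pi [Spi ipi]; apply: N; exists pi.
Qed.

Definition patch_off (S : set (pmeas R X)) (T : Type) (g : pmeas R X -> T)
  (t : T) pi : T := if pi \in S then g pi else t.

Lemma borel_patch_off (S : set (pmeas R X)) (T : finType) (g : pmeas R X -> T) t :
  countable S -> borel_map (patch_off S g t).
Proof.
move=> cS A.
have bI : borel (S `&` g @^-1` A).
  by apply: borel_countable; apply: sub_countable cS; apply: subset_card_le => pi [].
have bN : borel (S `&` ~` (g @^-1` A)).
  by apply: borel_countable; apply: sub_countable cS; apply: subset_card_le => pi [].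
have [At|At] := pselect (A t).
  rewrite (_ : _ @^-1` A = setT `\` (S `&` ~` (g @^-1` A))).
    exact: sigma_algebraCD.
  apply/seteqP; split => pi; rewrite /patch_off /=.
    by case: ifPn => [_ Agpi|]; [split=> // -[]|rewrite notin_setE => ? _; split=> // -[]].
  case=> _; case: ifPn => // /set_mem Spi.
  by have [//|NA] := pselect (A (g pi)) => /(_ (conj Spi NA)).
rewrite (_ : _ @^-1` A = S `&` g @^-1` A)//.
apply/seteqP; split => pi; rewrite /patch_off /=.
  by case: ifPn => // /set_mem.
by case=> Spi Agpi; rewrite mem_set.
Qed.

End borel_selectors.

(** All predictors obtained from [pi0] by finitely many updates, with arbitrary
    decisions and symbols; the set does not depend on a policy. *)
Definition reachable (R : realType) (X U M : finType) (K : X -> U -> X -> R)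
    (pi0 : pmeas R X) : set (pmeas R X) :=
  range (foldl (fun pi (a : quantizer X M * ctrl_map X U M * M) =>
                  predictor_step K a.1.1 a.1.2 a.2 pi) pi0).

Lemma reachable_countable (R : realType) (X U M : finType) (K : X -> U -> X -> R)
  (pi0 : pmeas R X) : countable (reachable M K pi0).
Proof. exact: sub_countable (card_image_le _ _) (countableP _). Qed.

Lemma predictor_reachable (R : realType) (X U M : finType) (K : X -> U -> X -> R)
    (pi0 : pmeas R X) (ge : pmeas R X -> quantizer X M)
    (gc : pmeas R X -> ctrl_map X U M) (s : seq M) :
  reachable M K pi0 (predictor K pi0 (fun=> ge) (fun=> gc) s).
Proof.
elim/last_ind: s => [|s m [l _ lE]]; first by exists [::].
rewrite predictor_rcons; set pi := predictor _ _ _ _ _ in lE *.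
by exists (rcons l (ge pi, gc pi, m)); rewrite // foldl_rcons lE.
Qed.

(** * Existence of an optimal stationary policy *)

Theorem mainTheorem4 (R : realType) (X U M : finType)
  (hX : (0 < #|X|)%N) (hU : (0 < #|U|)%N) (hM : (0 < #|M|)%N)
  (d : measure_display) (Om : measurableType d) (P : probability Om R)
  (d' : measure_display) (W : measurableType d')
  (f : X -> U -> W -> X)
  (f_meas : forall x u x', measurable [set v | f x u v = x'])
  (x0 : Om -> X) (x0_meas : forall x, measurable (x0 @^-1` [set x]))
  (pi0 : pmeas R X) (x0_law : forall x, P (x0 @^-1` [set x]) = (pi0 x)%:E)
  (w : nat -> {mfun Om >-> W})
  (w_id : identically_distributed P w)
  (w_indep : mutually_independent P w)
  (x0_w_indep : independent_of_process P x0 w)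
  (c : X -> U -> R) (beta : R) (beta01 : 0 < beta < 1) :
  exists (ge : pmeas R X -> quantizer X M) (gc : pmeas R X -> ctrl_map X U M),
    [/\ borel_map ge, borel_map gc &
        discounted_cost P f x0 w c beta
          (cp_policy (transition P f w) pi0 (fun=> ge) (fun=> gc)) =
        ereal_inf [set discounted_cost P f x0 w c beta g |
                    g in [set: adm_policy X U M]]].
Proof.
have [u0 _|/eq_card0 U0] := pickP (mem U); last by rewrite U0 in hU.
have [m0 _|/eq_card0 M0] := pickP (mem M); last by rewrite M0 in hM.
pose K := transition P f w.
have K_ge0 x u x' : 0 <= K x u x' by exact: transition_ge0.
have K_sum1 x u : \sum_x' K x u x' = 1 by exact: transition_sum1.
have pi_ge0 x : 0 <= pi0 x by exact: pmeas_ge0.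
pose a0 : quantizer X M * ctrl_map X U M := ([ffun=> m0], [ffun=> u0]).
pose V := value K c beta a0.
pose D := cost_bound c beta.
pose S := reachable M K pi0.
pose best (pi : pmeas R X) := greedy K c beta a0 V pi.
pose ge := patch_off S (fun pi => (best pi).1) a0.1.
pose gc := patch_off S (fun pi => (best pi).2) a0.2.
have S_countable : countable S by exact: reachable_countable.
exists ge, gc; split.
- exact: borel_patch_off.
- exact: borel_patch_off.
have b01 : 0 <= beta < 1 by case/andP: beta01 => /ltW -> ->.
have law0 : law pi0 (initial_history U M) = pi0.
  by apply/ffunP => x; rewrite ffunE (big_pred1 x).
have costE g N : \sum_(k < N) beta ^+ k * mean_cost P f x0 w c g k =
    \sum_x pi0 x * cost_to_go K c beta g N (initial_history U M x).
  rewrite -(mean_initial f_meas x0_meas w g (fun h => cost_to_go K c beta g N h) x0_law).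
  by rewrite (mean_cost_to_go f_meas x0_meas w_id w_indep x0_w_indep).
have lower (g : adm_policy X U M) : ((V pi0)%:E <= discounted_cost P f x0 w c beta g)%E.
  have [J -> Jcv] := discounted_costE P f_meas x0_meas w c g beta01.
  rewrite lee_fin; apply: (limit_ge_geometric_gap b01 Jcv (e := D)) => N.
  have := cost_to_go_ge_value c K_ge0 K_sum1 beta01 a0 g N (r := pi0)
    (h := initial_history U M) (s := [tuple]) (v := [tuple]) pi_ge0.
  by rewrite law0 mass_pmeas mulr1 -costE; apply.
have upper : (discounted_cost P f x0 w c beta
    (cp_policy K pi0 (fun=> ge) (fun=> gc)) <= (V pi0)%:E)%E.
  set g := cp_policy _ _ _ _.
  have [J -> Jcv] := discounted_costE P f_meas x0_meas w c g beta01.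
  rewrite lee_fin -lerN2.
  apply: (limit_ge_geometric_gap b01 (cvgN Jcv) (e := D)) => N.
  rewrite -lerBlDr -opprD lerN2 costE.
  have := @cost_to_go_greedy_le _ _ _ _ K c beta K_ge0 K_sum1 beta01 a0 pi0 ge gc _
    N 0%N X pi0 (initial_history U M) [tuple] [tuple] 1 pi_ge0.
  rewrite law0 mass_pmeas mulr1 scale1r; apply => // t s.
  rewrite /ge /gc /patch_off mem_set; last exact: predictor_reachable.
  by rewrite -surjective_pairing.
apply/eqP; rewrite eq_le; apply/andP; split.
  apply: le_ereal_inf_tmp => _ [g _ <-]; exact: le_trans upper (lower g).
by apply: ereal_inf_lbound; exists (cp_policy K pi0 (fun=> ge) (fun=> gc)).
Qed.
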